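(* Let $c,d$ be relatively prime integers with $0\le c\le d$, let $\mathbb{P}$ be the one-move rider with move set $\mathbf{M}=\{(c,d)\}$, let $\mathcal{B}\subset\mathbb{Z}^2$ be a convex board with multiset of line sizes $\mathbf{L}^{d/c}(\mathcal{B})$, and let $q\ge 1$ be an integer. Then the number $u_{\mathbb{P}}(q;\mathcal{B})$ of nonattacking configurations of $q$ unlabelled pieces $\mathbb{P}$ on $\mathcal{B}$ is $$u_{\mathbb{P}}(q;\mathcal{B})=\sum_{n_1\lambda_1+\dots+n_k\lambda_k=q}(-1)^{q-\sum_{i=1}^k n_i}\prod_{i=1}^k\frac{1}{\lambda_i^{n_i}\,n_i!}\left(\sum_{l\in\mathbf{L}^{d/c}(\mathcal{B})}l^{\lambda_i}\right)^{n_i},$$ where the outer sum runs over all integer partitions of $q$; for each partition, $\lambda_1,\dots,\lambda_k$ are the distinct positive integers appearing as parts and $n_1,\dots,n_k\ge 1$ are their respective multiplicities.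
   Context: A convex board $\mathcal{B}$ is a finite set of lattice points of the form $K\cap\mathbb{Z}^2$ with $K\subset\mathbb{R}^2$ bounded and convex. A one-move rider with move set $\mathbf{M}=\{(c,d)\}$ (where $c,d$ are relatively prime) is a piece that, from a lattice point $z$, attacks every lattice point $z+k(c,d)$ with $k\in\mathbb{Z}$, $k\neq 0$. A nonattacking configuration of $q$ pieces is a placement of $q$ identical (unlabelled) pieces on $q$ distinct points of $\mathcal{B}$ such that no piece attacks another; $u_{\mathbb{P}}(q;\mathcal{B})$ is the number of such configurations. For $b\in\mathbb{Z}$ let $l_{\mathcal{B}}^{d/c}(b)=\{(x,y)\in\mathcal{B}: dx-cy=b\}$, the set of board points on a line with direction vector $(c,d)$ (slope $d/c$, vertical if $c=0$). The multiset of line sizes is $\mathbf{L}^{d/c}(\mathcal{B})=\{|l_{\mathcal{B}}^{d/c}(b)| : b\in\mathbb{Z},\ l_{\mathcal{B}}^{d/c}(b)\neq\emptyset\}$, with one entry for each $b$ such that the line is nonempty. Sums over $\mathbf{L}^{d/c}(\mathcal{B})$ are taken with multiplicity. *)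

(* Defs.v *)
From HB Require Import structures.
From mathcomp Require Import all_boot all_order all_algebra.
From mathcomp Require Import finmap multiset.
From mathcomp Require Import all_classical all_reals all_analysis.

Set Implicit Arguments.
Unset Strict Implicit.
Unset Printing Implicit Defensive.

Import Order.TTheory GRing.Theory Num.Theory.
Import numFieldNormedType.Exports.

Local Open Scope fset_scope.
Local Open Scope mset_scope.
Local Open Scope ring_scope.

Definition convex_board (R : realType) (B : {fset int * int}) : Prop :=
  exists K : set (R^o * R^o),
    [/\ bounded_set K,
        convex_set K &
        forall x y : int, (x, y) \in B <-> K (x%:~R, y%:~R)].

Definition attacks (c d : int) (z w : int * int) : Prop :=
  exists2 k : int, k != 0 & w = (z.1 + k * c, z.2 + k * d).

Definition nonattacking (c d : int) (A : {fset int * int}) : Prop :=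
  forall z w, z \in A -> w \in A -> ~ attacks c d z w.

Definition num_nonattacking (c d : int) (q : nat) (B : {fset int * int}) : nat :=
  #|` [fset A in fpowerset B | (#|` A| == q) && `[< nonattacking c d A >]] |.

Definition board_line (c d : int) (B : {fset int * int}) (b : int) :
    {fset int * int} :=
  [fset z in B | d * z.1 - c * z.2 == b].

(* The values [b] for which [board_line c d B b] is nonempty are exactly those
   of the linear form on [B]; an [fset] lists each of them once, so that equal
   sizes coming from different lines are repeated in the multiset. *)
Definition line_sizes (c d : int) (B : {fset int * int}) : {mset nat} :=
  seq_mset [seq #|` board_line c d B b|
           | b <- enum_fset [fset d * z.1 - c * z.2 | z in B]].

(* A partition of [q] is given by its multiplicities: [m i] is the number of
   parts equal to [i].  Parts and multiplicities are at most [q], hence the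
   finite type; its distinct parts are the [i] such that [0 < m i]. *)
Definition is_partition (q : nat) (m : {ffun 'I_q.+1 -> 'I_q.+1}) : bool :=
  (m ord0 == 0 :> nat) && ((\sum_(i < q.+1) m i * i)%N == q).

(* Main.v *)
(** Since [c] and [d] are coprime, a configuration is nonattacking iff each line
    [d x - c y = b] carries at most one of its pieces.  Hence [u(q)] is the [q]-th
    elementary symmetric function of the line sizes, the coefficient of [X^q] in
    the product of the [1 + l X].  Newton's identities turn it into power sums;
    the partition sum satisfies the same recursion: [q] is the sum of the
    [i n_i], and [i n_i] times the weight of a partition of [q] is, up to sign,
    the [i]-th power sum times the weight of the partition of [q - i] obtained
    by removing one part [i]. *)

Require Import Defs.
From mathcomp Require Import all_boot all_order all_algebra.
From mathcomp Require Import finmap multiset.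
From mathcomp Require Import all_classical all_reals all_analysis.
From mathcomp Require Import ring zify.

Set Implicit Arguments.
Unset Strict Implicit.
Unset Printing Implicit Defensive.

Import Order.TTheory GRing.Theory Num.Theory.

Local Open Scope fset_scope.
Local Open Scope ring_scope.

(** * Newton's identities for a product of linear factors *)

Definition linear_factors (F : comNzRingType) (s : seq F) : {poly F} :=
  \prod_(l <- s) (1 + l *: 'X).

Lemma linear_factors_coef0 (F : comNzRingType) (s : seq F) :
  (linear_factors s)`_0 = 1.
Proof.
rewrite /linear_factors; elim: s => [|l s IHs]; first by rewrite big_nil coef1.
by rewrite big_cons mulrDl mul1r -scalerAl mulrC coefD coefZ coefMX mulr0 addr0.
Qed.

Lemma linear_factors_coefS (F : comNzRingType) (l : F) (s : seq F) k :
  (linear_factors (l :: s))`_k.+1 =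
  (linear_factors s)`_k.+1 + l * (linear_factors s)`_k.
Proof.
by rewrite /linear_factors big_cons mulrDl mul1r -scalerAl mulrC coefD coefZ coefMX.
Qed.

(** With [P] the product, this is the coefficient of [X^k] in [X P' = P * \sum_l l X / (1 + l X)].
    The induction on [s] plays the role of the Leibniz rule for one more factor. *)
Lemma newton_identity (F : comNzRingType) (s : seq F) k :
  k%:R * (linear_factors s)`_k =
  \sum_(i < k) (-1) ^+ i * (\sum_(l <- s) l ^+ i.+1) *
               (linear_factors s)`_(k.-1 - i).
Proof.
elim: s k => [|l s IHs] [|k]; rewrite ?mul0r ?big_ord0 //.
  rewrite /linear_factors big_nil coef1 mulr0 big1 // => i _.
  by rewrite big_nil mulr0 mul0r.
(* The identity for the factor [1 + l X] alone, times the other factors. *)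
have own m : \sum_(i < m) (-1) ^+ i * l ^+ i.+1 * (linear_factors (l :: s))`_(m.-1 - i)
    = if m is m'.+1 then l * (linear_factors s)`_m' else 0.
  elim: m => [|m IHm]; first by rewrite big_ord0.
  rewrite big_ord_recl subn0 expr0 mul1r expr1.
  have -> : \sum_(i < m) (-1) ^+ (lift ord0 i) * l ^+ (lift ord0 i).+1 *
      (linear_factors (l :: s))`_(m.+1.-1 - lift ord0 i) =
      - l * \sum_(i < m) (-1) ^+ i * l ^+ i.+1 * (linear_factors (l :: s))`_(m.-1 - i).
    rewrite mulr_sumr; apply: eq_bigr => i _.
    rewrite lift0 [_ ^+ i.+2]exprS [(-1) ^+ _]exprS !mulrA.
    have -> : (m.+1.-1 - i.+1 = m.-1 - i)%N by lia.
    by congr (_ * _); ring.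
  rewrite IHm; case: m {IHm} => [|m].
    by rewrite mulr0 addr0 !linear_factors_coef0.
  by rewrite linear_factors_coefS; ring.
under eq_bigr => i _ do rewrite big_cons mulrDr mulrDl.
rewrite big_split /= own.
(* Each coefficient for [l :: s] is expanded by its recursion. At [i = k] the coefficient is the
   constant one, equal to 1 for both lists, so the second sum stops at [k]. *)
have -> : \sum_(i < k.+1) (-1) ^+ i * (\sum_(j <- s) j ^+ i.+1) *
    (linear_factors (l :: s))`_(k - i) =
  \sum_(i < k.+1) (-1) ^+ i * (\sum_(j <- s) j ^+ i.+1) *
    (linear_factors s)`_(k.+1.-1 - i) +
  l * \sum_(i < k) (-1) ^+ i * (\sum_(j <- s) j ^+ i.+1) *
    (linear_factors s)`_(k.-1 - i).
  rewrite !big_ord_recr /= subnn !linear_factors_coef0 -addrA [_ * 1 + _]addrC.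
  rewrite addrA; congr (_ + _); rewrite mulr_sumr -big_split /=.
  apply: eq_bigr => i _.
  have -> : (k - i = (k.-1 - i).+1)%N by have := ltn_ord i; lia.
  by rewrite linear_factors_coefS; ring.
(* With [e] the coefficients for [s]: [l e_k + (k+1) e_(k+1) + l k e_k = (k+1) (e_(k+1) + l
   e_k)]. *)
by rewrite -!IHs linear_factors_coefS; ring.
Qed.

(** * The recursion for sums over partitions *)

Local Notation multiplicities N := {ffun 'I_N.+1 -> 'I_N.+1}.

(* Multiplicity vectors with an ambient size [N] independent of [q], so that
   partitions of different integers live in the same type. *)
Definition is_partition_in (N q : nat) (n : multiplicities N) : bool :=
  (n ord0 == 0 :> nat) && ((\sum_(i < N.+1) n i * i)%N == q).

(** Summed over the partitions of [q <= N], this gives the coefficient of [X^q] in the exponential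
    of [\sum_(i > 0) a_i X^i]. *)
Definition partition_weight (F : fieldType) (N : nat) (a : nat -> F)
    (n : multiplicities N) : F :=
  \prod_(i < N.+1) (a i ^+ n i / (n i)`!%:R).

Lemma partition_part_le (N q : nat) (n : multiplicities N) (i : 'I_N.+1) :
  is_partition_in q n -> (n i * i <= q)%N.
Proof. by case/andP=> _ /eqP<-; rewrite (bigD1 i) //= leq_addr. Qed.

Lemma sum_partition0 (F : fieldType) (N : nat) (a : nat -> F) :
  \sum_(n : multiplicities N | is_partition_in 0 n)
     partition_weight a n = 1.
Proof.
rewrite (big_pred1 [ffun=> ord0]) => [|n].
  by rewrite /partition_weight big1 // => i _; rewrite ffunE /= expr0 divr1.
rewrite /=; apply/idP/eqP => [pn|->].
  apply/ffunP => i; apply/val_inj; rewrite ffunE /=.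
  have := partition_part_le i pn; rewrite leqn0 muln_eq0 => /orP[/eqP//|/eqP i0].
  have -> : i = ord0 by apply/val_inj.
  by case/andP: pn => /eqP.
by rewrite /is_partition_in ffunE /= big1 // => i _; rewrite ffunE mul0n.
Qed.

(** Vectors with [n i = 0] contribute nothing. For the others, one part [i] is removed and [n_i
    a_i^(n_i) / n_i! = a_i * a_i^(n_i - 1) / (n_i - 1)!]. *)
Lemma sum_part_multiplicity (F : numFieldType) (N q : nat) (a : nat -> F) (i : 'I_N.+1) :
  (0 < i <= q)%N -> (q <= N)%N ->
  \sum_(n : multiplicities N | is_partition_in q n)
     (n i)%:R * partition_weight a n =
  a i * \sum_(n : multiplicities N | is_partition_in (q - i) n)
     partition_weight a n.
Proof.
case/andP=> i_gt0 le_iq le_qN.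
pose add (n : multiplicities N) : multiplicities N :=
  [ffun j => inord (n j + (j == i))].
pose rem (n : multiplicities N) : multiplicities N :=
  [ffun j => inord (n j - (j == i))].
have remE n j : rem n j = (n j - (j == i))%N :> nat.
  by rewrite ffunE inordK // (leq_ltn_trans (leq_subr _ _)).
(* [inord] must not overflow: [n i <= q - i] and [0 < i], hence [n i + 1 <= q <= N]. *)
have addK n : is_partition_in (q - i) n -> rem (add n) = n.
  move=> /(partition_part_le i) bd; apply/ffunP=> j; apply/val_inj.
  rewrite /= remE ffunE inordK ?addnK // ltnS.
  have [->|_] := eqVneq j i; last by rewrite addn0 -ltnS.
  have : (n i <= q - i)%N by apply: leq_trans bd; rewrite leq_pmulr.
  lia.
have remK (n : multiplicities N) : (0 < n i)%N -> add (rem n) = n.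
  move=> ni; apply/ffunP=> j; apply/val_inj.
  rewrite ffunE remE subnK ?inord_val //.
  by case: eqVneq => // ->.
(* If [n i = 0], truncated subtraction leaves it at 0 and [add] then makes it 1. *)
have remN (n : multiplicities N) : (add (rem n) == n) = (0 < n i)%N.
  apply/eqP/idP => [e|]; last exact: remK.
  have := remE n i; rewrite eqxx.
  case: posnP => // ni0 rni; suff : val (n i) = 1%N by rewrite /= ni0.
  by rewrite -e ffunE eqxx rni ni0 /= inordK //; have := ltn_ord i; lia.
rewrite (reindex_onto rem add addK) /= mulr_sumr.
rewrite (bigID (fun n : multiplicities N => 0 < n i)%N) /= addrC big1 ?add0r; last first.
  by move=> n /andP[_]; rewrite -eqn0Ngt => /eqP->; rewrite mul0r.
apply: eq_big => [n|n /andP[_ ni]].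
  rewrite remN; case: (boolP (0 < n i)%N) => ni; rewrite ?andbF ?andbT //.
  rewrite /is_partition_in remE.
  have -> : (ord0 == i) = false by apply/eqP=> e; move: i_gt0; rewrite -e.
  rewrite subn0; congr (_ && _).
  suff -> : (\sum_(j < N.+1) n j * j = \sum_(j < N.+1) rem n j * j + i)%N by lia.
  rewrite (bigD1 i) //= [in RHS](bigD1 i) //= remE eqxx.
  rewrite (eq_bigr (fun j : 'I_N.+1 => rem n j * j)%N).
    by rewrite subn1 -[in LHS](prednK ni) mulSn -addnA addnC.
  by move=> j /negbTE ji; rewrite remE ji subn0.
rewrite /partition_weight (bigD1 i) //= [in RHS](bigD1 i) //= remE eqxx.
rewrite (eq_bigr (fun j : 'I_N.+1 => a j ^+ rem n j / (rem n j)`!%:R)); last first.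
  by move=> j /negbTE ji; rewrite remE ji subn0.
rewrite !mulrA; congr (_ * _).
case: (nat_of_ord (n i)) ni => // k _; rewrite subn1 /= exprS factS natrM.
have k0 : k.+1%:R != 0 :> F by rewrite pnatr_eq0.
have f0 : k`!%:R != 0 :> F by rewrite pnatr_eq0 -lt0n fact_gt0.
by move: (k.+1%:R) k0 => r r0; field; rewrite f0.
Qed.

Lemma sum_partition_rec (F : numFieldType) (N q : nat) (a : nat -> F) :
  (q <= N)%N ->
  q%:R * \sum_(n : multiplicities N | is_partition_in q n)
           partition_weight a n =
  \sum_(i < q) i.+1%:R * a i.+1 *
     \sum_(n : multiplicities N | is_partition_in (q.-1 - i) n)
        partition_weight a n.
Proof.
move=> le_qN; rewrite mulr_sumr.
(* Replace [q] by the sum of the [i n_i] in each term, then exchange the two sums. *)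
transitivity (\sum_(i < N.+1) i%:R *
    \sum_(n : multiplicities N | is_partition_in q n)
       (n i)%:R * partition_weight a n).
  under [RHS]eq_bigr => i _ do rewrite mulr_sumr.
  rewrite exchange_big /=; apply: eq_bigr => n /andP[_ /eqP qE].
  rewrite -{1}qE natr_sum mulr_suml; apply: eq_bigr => i _.
  by rewrite natrM; ring.
rewrite big_ord_recl mul0r add0r [RHS](big_ord_widen _ (fun i => i.+1%:R * a i.+1 *
  \sum_(n : multiplicities N | is_partition_in (q.-1 - i) n)
     partition_weight a n) le_qN) [RHS]big_mkcond.
apply: eq_bigr => i _; rewrite lift0; case: ltnP => [lt_iq|le_qi].
  have -> : (q.-1 - i = q - lift ord0 i)%N by rewrite lift0; lia.
  by rewrite sum_part_multiplicity ?lift0 // mulrA.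
(* A part larger than [q] has multiplicity 0 in every partition of [q]. *)
rewrite big1 ?mulr0 // => n /(partition_part_le (lift ord0 i)); rewrite lift0 => bd.
suff -> : n (lift ord0 i) = 0%N :> nat by rewrite mul0r.
by case: (nat_of_ord (n _)) bd => // k; nia.
Qed.

(** Both sides satisfy the same recursion, since [i a_i] is the signed [i]-th power sum; it
    determines them because [q] is invertible when nonzero. [N] stays fixed through the strong
    induction. *)
Lemma linear_factors_coef_partition (F : numFieldType) (s : seq F) (N q : nat) :
  (q <= N)%N ->
  (linear_factors s)`_q =
  \sum_(n : multiplicities N | is_partition_in q n)
     partition_weight (fun i => (-1) ^+ i.-1 * (\sum_(l <- s) l ^+ i) / i%:R) n.
Proof.
elim/ltn_ind: q => -[|q] IHq le_qN.
  by rewrite linear_factors_coef0 sum_partition0.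
have q0 : q.+1%:R != 0 :> F by rewrite pnatr_eq0.
apply: (mulfI q0); rewrite newton_identity sum_partition_rec //.
apply: eq_bigr => i _; rewrite IHq; [|have := ltn_ord i; lia..].
congr (_ * _); have i0 : i.+1%:R != 0 :> F by rewrite pnatr_eq0.
by rewrite [RHS]mulrC mulfVK.
Qed.

(** * Counting partial transversals of the fibres of a map *)

(** Restricting the values to a list [bs] allows induction on one fibre at a time. *)
Definition partial_transversals (T U : choiceType) (f : T -> U) (B : {fset T})
    (bs : seq U) (q : nat) : {fset {fset T}} :=
  [fset A in fpowerset B | [&& #|` A| == q, all (fun z => f z \in bs) (enum_fset A)
                             & `[< {in A &, injective f} >]]].

Lemma partial_transversalsP (T U : choiceType) (f : T -> U) (B : {fset T})
    (bs : seq U) (q : nat) (A : {fset T}) :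
  reflect [/\ A `<=` B, #|` A| = q, {in A, forall z, f z \in bs}
            & {in A &, injective f}]
          (A \in partial_transversals f B bs q).
Proof.
rewrite !inE /= fpowersetE; apply: (iffP and4P).
  by case=> ? /eqP ? /allP ? /asboolP ?; split=> //.
by case=> *; split=> //; [apply/eqP|apply/allP|apply/asboolP].
Qed.

Lemma card_partial_transversals0 (T U : choiceType) (f : T -> U) (B : {fset T})
    (bs : seq U) : #|` partial_transversals f B bs 0| = 1%N.
Proof.
suff -> : partial_transversals f B bs 0 = [fset fset0] by rewrite cardfs1.
apply/fsetP => A; rewrite in_fset1; apply/partial_transversalsP/eqP.
  by case=> _ /cardfs0_eq.
by move=> ->; split=> //; rewrite ?fsub0set ?cardfs0.
Qed.

Lemma cardfsM (T U : choiceType) (A : {fset T}) (B : {fset U}) :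
  #|` A `*` B| = (#|` A| * #|` B|)%N.
Proof.
rewrite (perm_size (enum_imfset2 _ _)) /= ?size_allpairs //.
by move=> [x y] [x' y'] _ _ [-> ->].
Qed.

(** A transversal either misses the fibre over [b] or has exactly one point there, whose removal
    leaves a transversal over [bs]. This is the recursion of [linear_factors_coefS]. *)
Lemma card_partial_transversals_cons (T U : choiceType) (f : T -> U)
    (B : {fset T}) (b : U) (bs : seq U) (q : nat) : b \notin bs ->
  #|` partial_transversals f B (b :: bs) q.+1| =
  (#|` partial_transversals f B bs q.+1| +
   #|` [fset z in B | f z == b]| * #|` partial_transversals f B bs q|)%N.
Proof.
move=> b_bs; set fib := [fset z in B | f z == b].
have fibP z : reflect (z \in B /\ f z = b) (z \in fib).
  by rewrite !inE /=; apply: (iffP andP) => -[? /eqP].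
have avoid z A : z \in fib -> A \in partial_transversals f B bs q -> z \notin A.
  move=> /fibP[_ fz] /partial_transversalsP[_ _ Abs _].
  by apply: contra b_bs => /Abs; rewrite fz.
pose ext := [fset p.1 |` p.2 | p in fib `*` partial_transversals f B bs q].
(* The pair is recovered from the union: [z] is its only point over [b]. *)
have card_ext : #|` ext| = (#|` fib| * #|` partial_transversals f B bs q|)%N.
  rewrite -cardfsM card_in_imfset //= => -[z A] [z' A'].
  rewrite !in_fsetM /= => /andP[zf At] /andP[z'f A't] e.
  have zz' : z = z'.
    have : z \in z' |` A' by rewrite -e fset1U1.
    rewrite in_fset1U => /orP[/eqP//|zA'].
    by case/negP: (avoid _ _ zf A't).
  move: e; rewrite -zz' in z'f * => e; congr (_, _).
  by rewrite -(fsetU1K (avoid _ _ zf At)) e fsetU1K // avoid.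
have disj : [disjoint partial_transversals f B bs q.+1 & ext].
  apply/fdisjointP => A /partial_transversalsP[_ _ Abs _]; apply/imfsetP => -[[z A'] /=].
  rewrite in_fsetM => /andP[/= /fibP[_ fz] _] e.
  by case/negP: b_bs; rewrite -fz Abs // e fset1U1.
(* The subtracted 0 becomes the size of the empty intersection, as inclusion-exclusion requires. *)
rewrite -card_ext -[RHS]subn0 -(cardfs0 {fset T}).
move: disj; rewrite -fsetI_eq0 => /eqP <-; rewrite -cardfsU; congr #|` _|.
apply/fsetP => A; rewrite in_fsetU; apply/idP/orP; last first.
  case=> [/partial_transversalsP[AB cA Abs Ainj]|/imfsetP[[z A'] /=]].
    by apply/partial_transversalsP; split=> // z /Abs; rewrite inE orbC => ->.
  rewrite in_fsetM => /andP[/= zf At] ->; have zA' := avoid _ _ zf At.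
  case/fibP: zf => zB fz; case/partial_transversalsP: At => A'B cA' A'bs A'inj.
  apply/partial_transversalsP; split.
  - by rewrite fsubUset fsub1set zB.
  - by rewrite cardfsU1 zA' cA'.
  - move=> x; rewrite in_fset1U inE => /orP[/eqP->|/A'bs->]; first by rewrite fz eqxx.
    by rewrite orbT.
  - move=> x y; rewrite !in_fset1U => /orP[/eqP->|xA'] /orP[/eqP->|yA'] // e.
    + by case/negP: b_bs; rewrite -fz e A'bs.
    + by case/negP: b_bs; rewrite -fz -e A'bs.
    + exact: A'inj.
case/partial_transversalsP=> AB cA Abs Ainj.
have [/hasP[z zA /eqP fz]|/hasPn noz] := boolP (has (fun z => f z == b) (enum_fset A)).
  right; apply/imfsetP; exists (z, A `\ z) => /=; last by rewrite fsetD1K.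
  rewrite in_fsetM /=; apply/andP; split.
    by apply/fibP; split=> //; apply: (fsubsetP AB).
  apply/partial_transversalsP; split.
  - exact: fsubset_trans (fsubD1set _ _) AB.
  - by move: cA; rewrite (cardfsD1 z) zA => -[].
  - move=> x; rewrite in_fsetD1 => /andP[xz xA].
    have := Abs x xA; rewrite inE => /orP[/eqP fx|//].
    by case/eqP: xz; apply: Ainj; rewrite ?fx ?fz.
  - by move=> x y /[!in_fsetD1] /andP[_ xA] /andP[_ yA]; apply: Ainj.
left; apply/partial_transversalsP; split=> // z zA.
by have := Abs z zA; rewrite inE (negbTE (noz z zA)).
Qed.

Lemma card_partial_transversals (F : comNzRingType) (T U : choiceType)
    (f : T -> U) (B : {fset T}) (bs : seq U) (q : nat) : uniq bs ->
  #|` partial_transversals f B bs q|%:R =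
  (linear_factors [seq #|` [fset z in B | f z == b]|%:R | b <- bs])`_q :> F.
Proof.
elim: bs q => [|b bs IHbs] [|q] /=.
- by rewrite card_partial_transversals0 linear_factors_coef0.
- move=> _; rewrite /linear_factors big_nil coef1 /=.
  suff -> : partial_transversals f B [::] q.+1 = fset0 by rewrite cardfs0.
  apply/fsetP => A; rewrite in_fset0; apply/negP => /partial_transversalsP[_ cA Abs _].
  have /fset0Pn[z /Abs//] : A != fset0 by rewrite -cardfs_gt0 cA.
- by rewrite card_partial_transversals0 linear_factors_coef0.
case/andP=> b_bs bs_uniq.
by rewrite card_partial_transversals_cons // linear_factors_coefS natrD natrM !IHbs.
Qed.

(** * Attacks and the lines of the board *)

Lemma attacksP (c d : int) (z w : int * int) : coprimez c d ->
  attacks c d z w <-> z <> w /\ d * z.1 - c * z.2 = d * w.1 - c * w.2.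
Proof.
move=> cd; case: z w => x y [x' y']; rewrite /attacks /=; split.
  case=> k k0 [-> ->]; split; last by ring.
  case=> ex ey; case/eqP: k0.
  have kc : k * c = 0 by lia.
  have kd : k * d = 0 by lia.
  have /eqP := kc; rewrite mulf_eq0 => /orP[/eqP//|/eqP c0].
  have /eqP := kd; rewrite mulf_eq0 => /orP[/eqP//|/eqP d0].
  by move: cd; rewrite c0 d0.
case=> ne e; have e' : d * (x' - x) = c * (y' - y) by lia.
have /dvdzP[k kE] : (c %| x' - x)%Z.
  by rewrite -(Gauss_dvdzr _ cd) e' dvdz_mulr.
have /dvdzP[h hE] : (d %| y' - y)%Z.
  have dc : coprimez d c by rewrite coprimez_sym.
  by rewrite -(Gauss_dvdzr _ dc) -e' dvdz_mulr.
(* For a vertical move [k] is undetermined by [kE], so the multiplier is read off the second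
   coordinate; otherwise cancelling [c] shows that [k] serves both. *)
have [c0|c0] := eqVneq c 0.
  exists h; last by congr (_, _); rewrite ?c0 in kE *; lia.
  by apply/eqP => h0; apply: ne; congr (_, _); rewrite ?c0 ?h0 in kE hE; lia.
have hk : y' - y = k * d by apply: (mulfI c0); rewrite -e' kE; ring.
exists k; last by congr (_, _); lia.
by apply/eqP => k0; apply: ne; congr (_, _); rewrite k0 in kE hk; lia.
Qed.

Lemma nonattackingP (c d : int) (A : {fset int * int}) : coprimez c d ->
  nonattacking c d A <->
  {in A &, injective (fun z : int * int => d * z.1 - c * z.2)}.
Proof.
move=> cd; split=> [na z w zA wA e|Ainj z w zA wA /attacksP].
  by have [//|/eqP ne] := eqVneq z w; case: (na z w zA wA); apply/attacksP.
by case/(_ cd) => ne /(Ainj z w zA wA).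
Qed.

Lemma num_nonattackingE (F : comNzRingType) (c d : int) (q : nat)
    (B : {fset int * int}) : coprimez c d ->
  (num_nonattacking c d q B)%:R =
  (linear_factors [seq l%:R | l <- line_sizes c d B])`_q :> F.
Proof.
move=> cd; pose f (z : int * int) := d * z.1 - c * z.2.
have -> : linear_factors [seq l%:R | l <- line_sizes c d B] =
    linear_factors [seq #|` [fset z in B | f z == b]|%:R
                   | b <- enum_fset [fset f z | z in B]] :> {poly F}.
  (* The multiset lists the sizes only up to permutation, which the product ignores. *)
  rewrite /linear_factors /line_sizes big_map (perm_big _ (perm_eq_seq_mset _)) /=.
  by rewrite !big_map.
rewrite -card_partial_transversals ?fset_uniq //; congr (#|` _|%:R).
apply/fsetP => A; rewrite /num_nonattacking inE /= inE /= fpowersetE.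
apply/and3P/partial_transversalsP => [[AB /eqP cA /asboolP/nonattackingP Ainj]|].
  split=> // [z zA|]; last exact: Ainj.
  by apply/imfsetP; exists z => //; apply: (fsubsetP AB).
by case=> AB /eqP cA _ Ainj; split=> //; apply/asboolP/nonattackingP.
Qed.

Theorem proposition3p1 (R : realType) (c d : int) (B : {fset int * int}) (q : nat)
    (cd_coprime : coprimez c d) (c_ge0 : 0 <= c) (le_cd : c <= d)
    (B_convex : convex_board R B) (q_ge1 : (1 <= q)%N) :
  (num_nonattacking c d q B)%:R =
  \sum_(n : {ffun 'I_q.+1 -> 'I_q.+1} | is_partition n)
     (-1) ^+ (q - \sum_(lambda < q.+1 | 0 < n lambda) n lambda)%N *
     \prod_(lambda < q.+1 | (0 < n lambda)%N)
        (((lambda ^ n lambda * (n lambda)`!)%:R)^-1 *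
         (\sum_(l <- line_sizes c d B) l%:R ^+ lambda) ^+ n lambda) :> rat.
Proof.
rewrite num_nonattackingE // (linear_factors_coef_partition _ (leqnn q)).
apply: eq_bigr => n /andP[/eqP n0 /eqP nq].
have part_gt0 (i : 'I_q.+1) : (0 < n i)%N -> (0 < i)%N.
  rewrite !lt0n; apply: contraNneq => i0.
  by rewrite (_ : i = ord0) ?n0 //; apply/val_inj.
(* The signs [(-1)^(i-1)] inside the weights multiply to the exponent [\sum (i-1) n_i], which is [q]
   minus the number of parts. *)
have qE : (\sum_(i < q.+1 | 0 < n i) i.-1 * n i +
           \sum_(i < q.+1 | 0 < n i) n i = q)%N.
  rewrite -[RHS]nq -big_split [RHS](bigID (fun i => 0 < n i)%N) /=.
  rewrite [X in (_ + X)%N]big1 ?addn0 => [|i]; last by rewrite -eqn0Ngt => /eqP->.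
  by apply: eq_bigr => i /part_gt0/prednK {2}<-; rewrite mulnS mulnC addnC.
have -> : (q - \sum_(i < q.+1 | 0 < n i) n i =
           \sum_(i < q.+1 | 0 < n i) i.-1 * n i)%N by rewrite -[X in (X - _)%N]qE addnK.
rewrite -prodrXr -big_split /partition_weight [LHS](bigID (fun i => 0 < n i)%N) /=.
rewrite [X in _ * X]big1 ?mulr1 => [|i]; last first.
  by rewrite -eqn0Ngt => /eqP->; rewrite expr0 divr1.
apply: eq_bigr => i _; rewrite big_map !exprMn -exprM exprVn natrM natrX invfM.
by ring.
Qed.
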